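(* Let $n \ge 1$, and let $D_1$ and $D_2$ be decks that are permutations of the multiset $\{1^n, 2^n\}$. If $D_1$ is $R$-related to $D_2$, then for every integer $a \ge 1$ the transition probability from the deck $(1,2)^n$ to $D_1$ under an $a$-shuffle is equal to the transition probability from $(1,2)^n$ to $D_2$ under an $a$-shuffle.
   Context: A deck of $N$ cards is a finite sequence of $N$ labels, listed from top to bottom; labels may repeat, and cards with the same label are indistinguishable. The deck $(1,2)^n$ is the deck $1,2,1,2,\ldots,1,2$ of $2n$ cards. A shuffle of $N$ cards is a permutation $\pi \in S_N$; $\pi(i)=j$ means that the card in position $i$ is sent to position $j$, so $\pi$ applied to the deck $c_1,\ldots,c_N$ results in the deck $c_{\pi^{-1}(1)},\ldots,c_{\pi^{-1}(N)}$. The $a$-shuffle is the following probability distribution on $S_N$. Choose a sequence $(a_1,\ldots,a_N)$ uniformly from the $a^N$ integer sequences with $0 \le a_i < a$. Sort it stably: let $i_1,\ldots,i_N$ be the unique permutation of $\{1,\ldots,N\}$ with $a_{i_1}\le a_{i_2}\le\cdots\le a_{i_N}$ and $i_j<i_{j+1}$ whenever $a_{i_j}=a_{i_{j+1}}$. The resulting shuffle is $\pi$ with $\pi(k)=i_k$ for $1\le k\le N$. The transition probability from a deck $D$ to a deck $D'$ under an $a$-shuffle is the probability that an $a$-shuffle applied to $D$ results in $D'$. The relation $R$. For a finite sequence $\beta$ of $1$'s and $2$'s, $\beta^*$ denotes the sequence obtained by reversing the order of $\beta$ and then replacing each $1$ by $2$ and each $2$ by $1$. On the set of decks that are permutations of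 $\{1^n,2^n\}$, relate $\alpha\beta\gamma$ (concatenation of sequences of $1$'s and $2$'s) to $\alpha\beta^*\gamma$ whenever the number of $1$'s in $\beta$ equals the number of $2$'s in $\beta$ (no condition is imposed on the lengths of $\alpha$ and $\gamma$). $R$ is the equivalence relation obtained as the reflexive, transitive closure of this (symmetric) relation. *)

(* Defs.v *)
From Stdlib Require Import Relation_Operators.
From mathcomp Require Import all_boot all_order all_algebra all_fingroup.

Set Implicit Arguments.
Unset Strict Implicit.
Unset Printing Implicit Defensive.

(* [pi i = j] means that the card in position [i] is sent to position [j]. *)
Definition apply_shuffle (T : Type) (N : nat) (pi : 'S_N) (c : N.-tuple T) :
    N.-tuple T :=
  [tuple tnth c ((pi^-1)%g j) | j < N].

(* The sequence [i_k = pi k] is the stable sorting sequence of [w]. *)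
Definition stably_sorts (a N : nat) (w : {ffun 'I_N -> 'I_a}) (pi : 'S_N) :
    bool :=
  [forall j : 'I_N, forall k : 'I_N, (k == j.+1 :> nat) ==>
     (w (pi j) <= w (pi k)) && ((w (pi j) == w (pi k)) ==> (pi j < pi k))].

Lemma stably_sorts_exists_unique (a N : nat) (w : {ffun 'I_N -> 'I_a}) :
  exists! pi : 'S_N, stably_sorts w pi.
Proof.
pose r (i j : 'I_N) := (w i < w j) || (w i == w j) && (i <= j).
have r_tot : total r.
  move=> i j; rewrite /r eq_sym -!val_eqE /=.
  by case: (ltngtP (w i) (w j)) => //= _; exact: leq_total.
have r_tr : transitive r.
  move=> j i k; rewrite /r -!val_eqE /=.
  case: (ltngtP (w i) (w j)) => //= [ij _|->].
    case: (ltngtP (w j) (w k)) => //= [jk _|<-]; last by rewrite ij.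
    by rewrite (ltn_trans ij jk).
  case: (ltngtP (w j) (w k)) => //= _; exact: leq_trans.
have r_as : antisymmetric r.
  move=> i j; rewrite /r -!val_eqE /=.
  case: (ltngtP (w i) (w j)) => //= _.
  by rewrite -eqn_leq => /eqP /val_inj.
have sortE (pi : 'S_N) :
    stably_sorts w pi = sorted r [seq pi i | i <- enum 'I_N].
  case: (pickP (@predT 'I_N)) => [i0 _|no].
    have nthE (k : 'I_N) : nth (pi i0) [seq pi i | i <- enum 'I_N] k = pi k.
      rewrite (@nth_map _ i0 _ _ pi k (enum 'I_N)) ?size_enum_ord //.
      by rewrite nth_ord_enum.
    apply/idP/(sortedP (pi i0)) => [/forallP st i|st].
      rewrite size_map size_enum_ord => lti.
      have lti' : i < N by exact: ltnW.
      have := forallP (st (Ordinal lti')) (Ordinal lti).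
      rewrite eqxx implyTb -[i.+1]/(val (Ordinal lti)) (nthE (Ordinal lti')) nthE.
      rewrite /r -!val_eqE /=.
      by case: (ltngtP (w (pi _)) (w (pi _))) => //= _ /ltnW.
    apply/forallP => j; apply/forallP => k; apply/implyP => /eqP kj.
    have ltj : j.+1 < N by rewrite -kj.
    move: (st j); rewrite size_map size_enum_ord => /(_ ltj).
    rewrite -kj !nthE /r -!val_eqE /=.
    case: (ltngtP (w (pi _)) (w (pi _))) => //= _.
    rewrite leq_eqVlt => /orP[/eqP/val_inj/perm_inj jk|//].
    by move: kj; rewrite jk => /eqP; rewrite -[X in X == _]addn0 -addn1 eqn_add2l.
  have -> : enum 'I_N = [::] by apply: size0nil; rewrite -cardE; apply: eq_card0.
  by apply/forallP => j; have := no j.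
pose s := sort r (enum 'I_N).
have ss : size s == N by rewrite size_sort size_enum_ord.
pose t := Tuple ss.
have t_inj : injective (tnth t).
  by apply/tuple_uniqP; rewrite sort_uniq enum_uniq.
exists (perm t_inj); split.
  rewrite sortE; have -> : [seq perm t_inj i | i <- enum 'I_N] = s.
    rewrite -[RHS]/(tval t) -[in RHS](map_tnth_enum t).
    by apply: eq_map => i; rewrite permE.
  exact: sort_sorted.
move=> pi; rewrite sortE => srt.
have es : s = [seq pi i | i <- enum 'I_N].
  apply: (sorted_eq r_tr r_as) => //; first exact: sort_sorted.
  rewrite perm_sort; apply: uniq_perm; first exact: enum_uniq.
    by rewrite map_inj_uniq ?enum_uniq //; exact: perm_inj.
  move=> i; rewrite mem_enum inE; symmetry; apply/mapP.
  by exists ((pi^-1)%g i); rewrite ?mem_enum // permKV.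
apply/permP => i; rewrite permE (tnth_nth i) /= es.
by rewrite (nth_map i) ?size_enum_ord // nth_ord_enum.
Qed.

Definition shuffle_prob (a N : nat) (pi : 'S_N) : rat :=
  (#|[set w : {ffun 'I_N -> 'I_a} | stably_sorts w pi]|%:R / (a ^ N)%:R)%R.

Definition transition_prob (T : eqType) (a N : nat) (D D' : N.-tuple T) : rat :=
  (\sum_(pi : 'S_N | apply_shuffle pi D == D') shuffle_prob a pi)%R.

Lemma deck12_subproof (n : nat) : size (flatten (nseq n [:: 1; 2])) == 2 * n.
Proof. by elim: n => // n IHn; rewrite mulnS /= (eqP IHn). Qed.

Definition deck12 (n : nat) : (2 * n).-tuple nat := Tuple (deck12_subproof n).

Definition balanced_deck (n : nat) (D : seq nat) : bool :=
  perm_eq D (nseq n 1 ++ nseq n 2).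

Definition swap12 (x : nat) : nat :=
  if x == 1 then 2 else if x == 2 then 1 else x.

Definition star (b : seq nat) : seq nat := map swap12 (rev b).

Definition R_step (n : nat) (D D' : seq nat) : Prop :=
  balanced_deck n D /\ balanced_deck n D' /\
  exists al be ga : seq nat,
    D = al ++ be ++ ga /\ D' = al ++ star be ++ ga /\
    count_mem 1 be = count_mem 2 be.

Definition R_related (n : nat) : seq nat -> seq nat -> Prop :=
  clos_refl_trans (seq nat) (R_step n).

(* Main.v *)
(** Read an [a]-shuffle backwards: a word assigning each card of the final deck
    to one of [a] piles produces that deck from [(1,2)^n] exactly when the
    piles, put one after the other, read [1,2,1,2,...].  Let each pile carry a
    state in [{1,2}], the label it needs next; a card labelled [x] goes to a
    pile in state [x] and flips its state.  The number of admissible words is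
    then a sum of entries of the product, along the deck, of the matrices
    [E] (label 1) and [F] (label 2) that flip some pile from 1 to 2,
    respectively from 2 to 1.  The entries that occur do not depend on the deck:
    every pile must end in the state in which the next one starts, cyclically.

    [E] and [F] are transposes of each other and are the raising and lowering
    operators of sl_2 acting on the [a]-th tensor power of C^2.  A product of
    as many [E]'s as [F]'s lies in the zero-weight subalgebra, which is
    commutative, being generated by [H = EF - FE] and [EF]; as both generators
    are symmetric, so is every such product.  Since transposition turns the
    product along [beta] into the product along [beta^*], balanced factors may be
    replaced by their stars. *)
Require Import Defs.
From mathcomp Require Import all_boot all_order all_algebra all_fingroup.

Set Implicit Arguments.
Unset Strict Implicit.
Unset Printing Implicit Defensive.

Import GRing.Theory.

(** * The zero-weight subalgebra of an abstract sl_2 pair with transposition *)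

Section ZeroWeight.
Local Open Scope ring_scope.

Variables (R : pzRingType) (E F : R) (tr : R -> R).
Let H := E * F - F * E.
Hypothesis HE : H * E = E * H + E *+ 2.
Hypotheses (trD : {morph tr : x y / x + y}) (trN : {morph tr : x / - x}).
Hypotheses (trM : forall x y, tr (x * y) = tr y * tr x) (tr1 : tr 1 = 1).
Hypotheses (trE : tr E = F) (trF : tr F = E).

Inductive zero_weight : R -> Prop :=
| zero_weight1 : zero_weight 1
| zero_weightH : zero_weight H
| zero_weightEF : zero_weight (E * F)
| zero_weightD x y : zero_weight x -> zero_weight y -> zero_weight (x + y)
| zero_weightN x : zero_weight x -> zero_weight (- x)
| zero_weightM x y : zero_weight x -> zero_weight y -> zero_weight (x * y).

Hint Constructors zero_weight : core.

Let trH : tr H = H.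
Proof. by rewrite trD trN !trM trE trF. Qed.

Let FH : F * H = H * F + F *+ 2.
Proof.
by have := congr1 tr HE; rewrite mulr2n !trD !trM trH trE mulr2n.
Qed.

Let EH : E * H = (H - 1 - 1) * E.
Proof. by rewrite -addrA -opprD mulrBl HE mulrDl mul1r mulr2n addrK. Qed.

Let FE : F * E = E * F - H.
Proof. by rewrite /H opprB addrC subrK. Qed.

Let comm_H_EF : GRing.comm H (E * F).
Proof.
rewrite /GRing.comm mulrA HE mulrDl -(mulrA E H F) -(mulrA E F H) FH.
by rewrite mulrDr mulrnAl mulrnAr.
Qed.

(** Commuting with [H] and [E * F] passes to all that they generate. [gen] is used twice, to reduce
    [y] and then [x] to a generator, which leaves [comm_H_EF]. *)
Lemma zero_weight_comm x y :
  zero_weight x -> zero_weight y -> GRing.comm x y.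
Proof.
have gen z : GRing.comm z H -> GRing.comm z (E * F) ->
    forall u, zero_weight u -> GRing.comm z u.
  move=> zH zX u; elim=> //.
  - exact: commr1.
  - by move=> *; apply: commrD.
  - by move=> *; apply: commrN.
  - by move=> *; apply: commrM.
move=> zx; apply: (gen x); exact/esym/gen.
Qed.

(** [tr] fixes both generators, and commutativity undoes its reversal of products. *)
Lemma zero_weight_tr x : zero_weight x -> tr x = x.
Proof.
elim=> // [|u v _ Hu _ Hv|u _ Hu|u v zu Hu zv Hv].
- by rewrite trM trE trF.
- by rewrite trD Hu Hv.
- by rewrite trN Hu.
- by rewrite trM Hu Hv zero_weight_comm.
Qed.

(** Lets a word be normalised with its zero-weight factor on the left; on generators, [E] shifts [H]
    to [H - 2] and [E * F] to [E * F + H - 2]. *)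
Lemma zero_weight_pushE x :
  zero_weight x -> exists2 y, zero_weight y & E * x = y * E.
Proof.
elim=> [||| u v _ [u' zu Hu] _ [v' zv Hv] | u _ [u' zu Hu]
       | u v _ [u' zu Hu] _ [v' zv Hv]].
- by exists 1; rewrite ?mulr1 ?mul1r.
- by exists (H - 1 - 1); rewrite ?EH //; auto.
- exists (E * F + (H - 1 - 1)); first by auto 6.
  by rewrite mulrDl -EH -mulrA FE mulrBr subrK.
- by exists (u' + v'); auto; rewrite mulrDr mulrDl Hu Hv.
- by exists (- u'); auto; rewrite mulrN mulNr Hu.
- by exists (u' * v'); auto; rewrite mulrA Hu -mulrA Hv mulrA.
Qed.

Lemma zero_weight_pushF x :
  zero_weight x -> exists2 y, zero_weight y & F * x = y * F.
Proof.
elim=> [||| u v _ [u' zu Hu] _ [v' zv Hv] | u _ [u' zu Hu]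
       | u v _ [u' zu Hu] _ [v' zv Hv]].
- by exists 1; rewrite ?mulr1 ?mul1r.
- by exists (H + 1 + 1); auto; rewrite FH !mulrDl mul1r mulr2n addrA.
- by exists (E * F - H); auto; rewrite mulrA FE.
- by exists (u' + v'); auto; rewrite mulrDr mulrDl Hu Hv.
- by exists (- u'); auto; rewrite mulrN mulNr Hu.
- by exists (u' * v'); auto; rewrite mulrA Hu -mulrA Hv mulrA.
Qed.

(* At most one of the two truncated differences is nonzero. *)
Lemma word_weightE (b : seq bool) :
  exists2 z, zero_weight z &
    \prod_(x <- b) (if x then E else F) =
    z * (E ^+ (count_mem true b - count_mem false b)
         * F ^+ (count_mem false b - count_mem true b)).
Proof.
elim: b => [|x b [z zz IH]].
  by exists 1; rewrite // big_nil /= !expr0 !mulr1.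
rewrite big_cons {}IH mulrA; case: x => /=; rewrite add0n add1n.
  have [z' zz' ->] := zero_weight_pushE zz.
  case: (leqP (count_mem false b) (count_mem true b)) => h.
    exists z' => //; rewrite subSn // exprS !mulrA.
    by rewrite (eqP h) (eqP (leqW h)).
  (* Here the word has surplus [F]'s: the new [E] pairs with one of them, and [E * F] joins the
     zero-weight factor. *)
  exists (z' * (E * F)); first by auto.
  by rewrite (eqP h) (eqP (ltnW h)) -subnSK // exprS expr0 !mul1r !mulrA.
have [z' zz' ->] := zero_weight_pushF zz.
case: (leqP (count_mem true b) (count_mem false b)) => h.
  exists z' => //; rewrite (eqP h) (eqP (leqW h)) subSn // !expr0 exprS.
  by rewrite !mul1r !mulrA.
exists (z' * (E * F - H)); first by auto.
by rewrite (eqP h) (eqP (ltnW h)) -subnSK // -FE exprS expr0 !mulr1 !mulrA.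
Qed.

Lemma tr_balanced_word (b : seq bool) : count_mem true b = count_mem false b ->
  tr (\prod_(x <- b) (if x then E else F)) = \prod_(x <- b) (if x then E else F).
Proof.
move=> bal; have [z zz ->] := word_weightE b.
by rewrite bal subnn !expr0 !mulr1 zero_weight_tr.
Qed.

End ZeroWeight.

(** * Transfer matrices of the piles *)

Section TransferMatrix.
Variable C : finType.

Local Notation state := {ffun C -> bool}.

Definition letter (q : bool) : nat := if q then 1 else 2.

Definition flip (c : C) (s : state) : state :=
  [ffun d => (d == c) (+) s d].

Definition step (x : nat) (c : C) (s : state) : option state :=
  if x == letter (s c) then Some (flip c s) else None.

Definition pfun_mx (T : finType) (f : T -> option T) : 'M[int]_#|T| :=
  \matrix_(i, j) (f (enum_val i) == Some (enum_val j))%:R%R.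

Definition step_mx (x : nat) (c : C) : 'M[int]_#|{: state}| :=
  pfun_mx (step x c).

Definition letter_mx (x : nat) : 'M[int]_#|{: state}| :=
  (\sum_c step_mx x c)%R.

Definition deck_mx (D : seq nat) : 'M[int]_#|{: state}| :=
  (\prod_(x <- D) letter_mx x)%R.

Lemma pfun_mxM (T : finType) (f g : T -> option T) :
  (pfun_mx f * pfun_mx g = pfun_mx (fun s => obind g (f s)))%R.
Proof.
apply/matrixP => i j; rewrite !mxE.
case fi: (f (enum_val i)) => [u|] /=; last first.
  by apply: big1 => k _; rewrite !mxE fi mul0r.
rewrite (bigD1 (enum_rank u)) //= !mxE enum_rankK fi eqxx mul1r big1 ?addr0 //.
move=> k; rewrite !mxE fi => ku; case: eqP => [[uk]|]; last by rewrite mul0r.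
by rewrite uk enum_valK eqxx in ku.
Qed.

Lemma pfun_mx0 (T : finType) (f : T -> option T) :
  (forall s, f s = None) -> pfun_mx f = 0%R.
Proof. by move=> f0; apply/matrixP => i j; rewrite !mxE f0. Qed.

Lemma eq_pfun_mx (T : finType) (f g : T -> option T) :
  f =1 g -> pfun_mx f = pfun_mx g.
Proof. by move=> fg; apply/matrixP => i j; rewrite !mxE fg. Qed.

Lemma flipK c : involutive (flip c).
Proof. by move=> s; apply/ffunP => d; rewrite !ffunE addbA addbb. Qed.

Lemma flipC c d s : flip c (flip d s) = flip d (flip c s).
Proof. by apply/ffunP => e; rewrite !ffunE addbCA. Qed.

Lemma flip_eq c s : flip c s c = ~~ s c.
Proof. by rewrite ffunE eqxx. Qed.

Lemma flip_neq c d s : d != c -> flip c s d = s d.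
Proof. by rewrite ffunE => /negbTE ->. Qed.

Lemma step_mx_comm x y c d : c != d ->
  (step_mx x c * step_mx y d = step_mx y d * step_mx x c)%R.
Proof.
move=> cd; rewrite !pfun_mxM; apply: eq_pfun_mx => s; rewrite /step.
have dc : d != c by rewrite eq_sym.
case: ifP => xc; case: ifP => yd //=.
- by rewrite !flip_neq // xc yd flipC.
- by rewrite flip_neq // yd.
- by rewrite flip_neq // xc.
Qed.

Lemma step_mx_sq x c : (step_mx x c * step_mx x c = 0)%R.
Proof.
rewrite pfun_mxM; apply: pfun_mx0 => s; rewrite /step.
by case: ifP => //= /eqP ->; rewrite flip_eq; case: (s c).
Qed.

Lemma step_mx121 c : (step_mx 1 c * step_mx 2 c * step_mx 1 c = step_mx 1 c)%R.
Proof.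
rewrite !pfun_mxM; apply: eq_pfun_mx => s; rewrite /step.
case sc: (s c) => //=.
by rewrite flip_eq sc /= flip_eq flip_eq sc /= flipK.
Qed.

Lemma swap12_letter x q : (swap12 x == letter q) = (x == letter (~~ q)).
Proof. by case: x q => [|[|[|x]]] []. Qed.

(** A flip is undone by flipping the same pile again, which takes the other label. *)
Lemma step_mx_tr x c : ((step_mx x c)^T = step_mx (swap12 x) c)%R.
Proof.
apply/matrixP => i j; rewrite !mxE; congr (nat_of_bool _)%:R%R.
set s := enum_val i; set t := enum_val j; rewrite /step swap12_letter.
by apply/eqP/eqP; case: eqP => // -> [<-]; rewrite flip_eq ?negbK eqxx flipK.
Qed.

Lemma letter_mx_tr x : ((letter_mx x)^T = letter_mx (swap12 x))%R.
Proof.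
by rewrite raddf_sum; apply: eq_bigr => c _; exact: step_mx_tr.
Qed.

Lemma deck_mx_star b : deck_mx (star b) = ((deck_mx b)^T)%R.
Proof.
elim: b => [|x b IH]; first by rewrite /deck_mx !big_nil trmx1.
rewrite /star rev_cons map_rcons -cats1 /deck_mx big_cat big_seq1 big_cons.
by rewrite trmx_mul letter_mx_tr; congr (_ *m _)%R; exact: IH.
Qed.

(** Distinct piles commute, so [H] is the sum of the one-pile commutators [h c], and the relation
    reduces to one pile. There it follows from $e^2 = 0$ and $efe = e$. *)
Lemma letter_mx_sl2 :
  let E := letter_mx 1 in let F := letter_mx 2 in let H := (E * F - F * E)%R in
  (H * E = E * H + E *+ 2)%R.
Proof.
move=> E F H.
pose h c := (step_mx 1 c * step_mx 2 c - step_mx 2 c * step_mx 1 c)%R.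
have -> : H = (\sum_c h c)%R.
  have EF : (E * F = \sum_c step_mx 1 c * F)%R by rewrite mulr_suml.
  have FE : (F * E = \sum_c F * step_mx 1 c)%R by rewrite mulr_sumr.
  rewrite /H EF FE -sumrB; apply: eq_bigr => c _.
  rewrite mulr_sumr mulr_suml -sumrB (bigD1 c) //= big1 ?addr0 // => d dc.
  by rewrite step_mx_comm 1?eq_sym // subrr.
apply/eqP; rewrite addrC -subr_eq mulr_suml mulr_sumr -sumrB -sumrMnl.
apply/eqP/eq_bigr => c _.
rewrite mulr_sumr mulr_suml -sumrB (bigD1 c) //= big1 ?addr0 => [|d dc].
  rewrite mulrBl mulrBr step_mx121 -mulrA step_mx_sq mulr0 subr0.
  by rewrite mulrA step_mx_sq mul0r sub0r opprK mulrA step_mx121 mulr2n.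
have comm y : GRing.comm (step_mx 1 d) (step_mx y c) by exact: step_mx_comm.
by apply/eqP; rewrite subr_eq0; apply/eqP/esym; apply: commrB; apply: commrM.
Qed.

Lemma deck_mx_balanced b :
  all (mem [:: 1; 2]) b -> count_mem 1 b = count_mem 2 b ->
  ((deck_mx b)^T = deck_mx b)%R.
Proof.
move=> b12 bal; have -> : deck_mx b = (\prod_(x <- map (pred1 1) b)
    (if x then letter_mx 1 else letter_mx 2))%R.
  rewrite big_map; apply: eq_big_seq => x /(allP b12).
  by rewrite !inE => /orP[] /eqP ->.
apply: (@tr_balanced_word _ _ _ (@trmx int _ _)).
- exact: letter_mx_sl2.
- exact: raddfD.
- exact: raddfN.
- by move=> x y; exact: trmx_mul.
- exact: trmx1.
- exact: letter_mx_tr.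
- exact: letter_mx_tr.
- rewrite !count_map; transitivity (count_mem 1 b).
    by apply: eq_count => x /=; rewrite eqb_id.
  rewrite bal; apply: eq_in_count => x xb.
  by have := allP b12 _ xb; rewrite !inE /= => /orP[] /eqP->.
Qed.

End TransferMatrix.

(** * Shuffles read backwards as piles *)

Section InverseShuffle.
Variables (a N : nat).
Implicit Types w : {ffun 'I_N -> 'I_a}.

(** The stable sorting sequence $i_1,\ldots,i_N$ of [w] in closed form. *)
Definition pile_order w : seq 'I_N :=
  flatten [seq [seq i <- enum 'I_N | w i == c] | c <- enum 'I_a].

(** Both lists are strictly increasing for the lexicographic order on (pile, position) and have the
    same members, hence coincide. *)
Lemma stably_sorts_pile_order w (pi : 'S_N) :
  stably_sorts w pi -> [seq pi k | k <- enum 'I_N] = pile_order w.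
Proof.
move=> st; pose r (i j : 'I_N) := (w i < w j) || (w i == w j) && (i < j).
have r_tr : transitive r.
  move=> j i k; rewrite /r -!val_eqE /=.
  case: (ltngtP (w i) (w j)) => //= [ij _|->].
    case: (ltngtP (w j) (w k)) => //= [jk _|<-]; last by rewrite ij.
    by rewrite (ltn_trans ij jk).
  case: (ltngtP (w j) (w k)) => //= _; exact: ltn_trans.
have r_irr : irreflexive r by move=> i; rewrite /r !ltnn andbF.
have enum_lt n : pairwise (relpre val ltn) (enum 'I_n).
  rewrite -pairwise_map val_enum_ord -sorted_pairwise ?iota_ltn_sorted //.
  exact: ltn_trans.
apply: (irr_sorted_eq r_tr r_irr).
- rewrite sorted_map.
  have : sorted (fun j k : 'I_N => k == j.+1 :> nat) (enum 'I_N).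
    rewrite -(sorted_map (f := val) (e' := fun j k => k == j.+1)) val_enum_ord.
    by case: N => //= n; elim: n 0 => //= n IH k; rewrite eqxx IH.
  apply: sub_sorted => j k /= kj; rewrite /r -!val_eqE /=.
  have /forallP/(_ j)/forallP/(_ k)/implyP/(_ kj) := st.
  by rewrite -!val_eqE /=; case: (ltngtP (w (pi j)) (w (pi k))).
- rewrite sorted_pairwise // /pile_order.
  elim: (enum 'I_a) (enum_lt a) => //= c cs IH /andP[/allP c_lt /IH {}IH].
  rewrite pairwise_cat IH andbT; apply/andP; split.
    apply/allrelP => i j; rewrite mem_filter => /andP[/eqP wi _].
    case/flatten_mapP => d /c_lt /= cd; rewrite mem_filter => /andP[/eqP wj _].
    by rewrite /r wi wj cd.
  apply: (sub_in_pairwise (P := [pred i | w i == c]) (r := relpre val ltn)).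
  + by move=> i j /eqP wi /eqP wj /= ij; rewrite /r wi wj eqxx ij orbT.
  + exact: filter_all.
  + by apply: pairwise_filter; exact: enum_lt.
- move=> i; apply/mapP/flatten_mapP => [_|_].
    by exists (w i); rewrite ?mem_enum // mem_filter eqxx mem_enum.
  by exists ((pi^-1)%g i); rewrite ?permKV // mem_enum.
Qed.

Lemma size_pile_order w : size (pile_order w) = N.
Proof.
have [pi [st _]] := stably_sorts_exists_unique w.
by rewrite -(stably_sorts_pile_order st) size_map size_enum_ord.
Qed.

(** Each word sorts to exactly one shuffle, so the double sum counts words. As card $k$ of [D] lands
    in position $i_k$, reading [D'] along the piles must return [D]. *)
Lemma transition_probE (T : eqType) (D D' : N.-tuple T) :
  transition_prob a D D' =
  (#|[set w : {ffun 'I_N -> 'I_a} |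
      [seq tnth D' i | i <- pile_order w] == D]|%:R / (a ^ N)%:R)%R.
Proof.
rewrite /transition_prob /shuffle_prob -mulr_suml -natr_sum; congr (_%:R / _)%R.
under eq_bigr => pi _ do rewrite -sum1dep_card.
rewrite (exchange_big_dep xpredT) //= -sum1dep_card [RHS]big_mkcond.
apply: eq_bigr => w _; have [pi [st uniq_pi]] := stably_sorts_exists_unique w.
rewrite (eq_bigl (fun p => (p == pi) && (apply_shuffle pi D == D'))); last first.
  move=> p; rewrite andbC; case: (p =P pi) => [->|p_pi]; first by rewrite st.
  by case: (boolP (stably_sorts w p)) => // /uniq_pi/esym.
rewrite big_mkcondr big_pred1_eq; congr (if _ then _ else _).
rewrite -(stably_sorts_pile_order st) -map_comp.
apply/eqP/eqP => [<-|DE].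
  rewrite -[RHS]map_tnth_enum; apply: eq_map => i /=.
  by rewrite tnth_mktuple permK.
apply: eq_from_tnth => i; rewrite tnth_mktuple (tnth_nth (tnth D' i)) -DE.
by rewrite (nth_map i) ?size_enum_ord // nth_ord_enum /= permKV.
Qed.

End InverseShuffle.

(** * Piles as two-state automata, counted by matrix entries *)

Fixpoint alternates (q : bool) (u : seq nat) : option bool :=
  if u is x :: v then if x == letter q then alternates (~~ q) v else None
  else Some q.

Lemma alternates_cat q u v :
  alternates q (u ++ v) = obind (alternates^~ v) (alternates q u).
Proof. by elim: u q => //= x u IH q; case: ifP. Qed.

Lemma alternates_deck12 n u : size u = 2 * n ->
  (alternates true u == Some true) = (u == deck12 n).
Proof.
rewrite /=; elim: n u => [|n IH]; first by case.
rewrite mulnS => -[|x [|y u]] //= [/IH {}IH].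
by rewrite !eqseq_cons; case: (x == 1); case: (y == 2).
Qed.

Section Walk.
Variables (C I : finType) (x : I -> nat) (w : I -> C).

(* Matrices act on row vectors, so the left factor is the first card. *)
Lemma prod_step_mxE (e : seq I) (s t : {ffun C -> bool}) :
  (\prod_(i <- e) step_mx (x i) (w i))%R (enum_rank s) (enum_rank t) =
  [forall c, alternates (s c) [seq x i | i <- e & w i == c] == Some (t c)]%:R%R.
Proof.
elim: e s => [|i e IH] s.
  rewrite big_nil mxE (can_eq enum_rankK); congr (nat_of_bool _)%:R%R.
  apply/eqP/forallP => [-> c //|st]; apply/ffunP => c.
  by have /eqP[] := st c.
rewrite big_cons [LHS]mxE.
under [LHS]eq_bigr => k _ do rewrite [X in (X * _)%R]mxE enum_rankK /step.
case: ifP => [/eqP xs|xs]; last first.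
  rewrite big1 => [|k _]; last by rewrite mul0r.
  by case: forallP => // /(_ (w i)); rewrite /= eqxx /= xs.
rewrite (bigD1 (enum_rank (flip (w i) s))) //= enum_rankK eqxx mul1r.
rewrite [X in (_ + X)%R]big1 ?addr0 => [|k nk]; last first.
  case: eqP => [[sk]|]; last by rewrite mul0r.
  by rewrite sk enum_valK eqxx in nk.
rewrite IH; congr (nat_of_bool _)%:R%R; apply: eq_forallb => c.
case: (w i =P c) => [<-|/eqP wc] /=; first by rewrite xs eqxx flip_eq.
by rewrite flip_neq // eq_sym.
Qed.

End Walk.

(** Distributing the product over the sums on piles gives one term for each assignment of cards to
    piles. *)
Lemma deck_mxE (C : finType) N (D : N.-tuple nat) (s t : {ffun C -> bool}) :
  deck_mx C D (enum_rank s) (enum_rank t) =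
  #|[set w : {ffun 'I_N -> C} | [forall c, alternates (s c)
      [seq tnth D i | i <- enum 'I_N & w i == c] == Some (t c)]]|%:R%R.
Proof.
rewrite /deck_mx big_tuple bigA_distr_bigA /= summxE.
rewrite -sum1dep_card natr_sum [RHS]big_mkcond; apply: eq_bigr => w _.
rewrite -[index_enum _]enumT prod_step_mxE.
by case: ifP.
Qed.

(* The starting states of the piles are determined by the deck: each pile
   starts in the state where the previous one ends. *)
Lemma alternates_flatten a (V : 'I_a.+1 -> seq nat) :
  #|[set s : {ffun 'I_a.+1 -> bool} | s ord0 &&
     [forall c, alternates (s c) (V c) == Some (s (ordS c))]]| =
  (alternates true (flatten [seq V c | c <- enum 'I_a.+1]) == Some true).
Proof.
pose pre k := flatten [seq V c | c <- take k (enum 'I_a.+1)].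
have preS (c : 'I_a.+1) : pre c.+1 = pre c ++ V c.
  rewrite /pre (take_nth c) ?size_enum_ord // nth_ord_enum.
  by rewrite map_rcons flatten_rcons.
have pre_all : pre a.+1 = flatten [seq V c | c <- enum 'I_a.+1].
  by rewrite /pre take_oversize // size_enum_ord.
have ordS_max : ordS ord_max = ord0 :> 'I_a.+1.
  by apply: val_inj; rewrite /= modnn.
have start (s : {ffun 'I_a.+1 -> bool}) :
    s ord0 ->
    (forall c, alternates (s c) (V c) = Some (s (ordS c))) ->
    forall c : 'I_a.+1, alternates true (pre c) = Some (s c).
  move=> s0 sV [k ltk]; elim: k ltk => [|k IH] ltk.
    by rewrite /= /pre take0 /= -s0; congr (Some (s _)); exact: val_inj.
  have ltk' : k < a.+1 by exact: ltnW.
  rewrite /= -[k]/(val (Ordinal ltk')) preS alternates_cat IH /= sV.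
  by congr (Some (s _)); apply: val_inj; rewrite /= modn_small.
rewrite -pre_all; case: eqP => [acc|nacc]; last first.
  apply: eq_card0 => s; rewrite inE; apply/negP => /andP[s0 /forallP sV].
  case: nacc; have {}sV c := eqP (sV c).
  rewrite -[a]/(val (@ord_max a)) preS alternates_cat (start s) //= sV.
  by rewrite ordS_max s0.
(* Pile [c] starts in the state left by the piles before it. The default is never reached: prefixes
   of an accepted word are accepted ([defined]). *)
pose s := [ffun c : 'I_a.+1 => odflt true (alternates true (pre c))].
apply/eqP/cards1P; exists s; apply/setP => u; rewrite !inE.
apply/andP/eqP => [[u0 /forallP uV]|->].
  by apply/ffunP => c; rewrite ffunE (start u) // => d; exact/eqP.
have defined k :
    alternates true (pre k) = Some (odflt true (alternates true (pre k))).
  move: acc; rewrite pre_all -(cat_take_drop k (enum _)) map_cat flatten_cat.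
  by rewrite alternates_cat -/(pre k); case: alternates.
split; first by rewrite ffunE /pre take0.
apply/forallP => c; rewrite !ffunE; apply/eqP.
have := defined c.+1; rewrite {1}preS alternates_cat defined /= => ->.
have [ca|] := ltnP c a; first by rewrite modn_small.
rewrite leq_eqVlt ltnNge -ltnS ltn_ord orbF => /eqP/esym ca.
by rewrite ca modnn acc /pre take0.
Qed.

(** By [alternates_flatten], a good word is counted for exactly one starting state [s] and a bad
    word for none. The shift [ordS] wraps around because the whole deck ends in the state it starts
    in. *)
Lemma card_pile_order a n (D : (2 * n).-tuple nat) :
  (#|[set w : {ffun 'I_(2 * n) -> 'I_a.+1} |
      [seq tnth D i | i <- pile_order w] == deck12 n]|%:R =
  \sum_(s : {ffun 'I_a.+1 -> bool} | s ord0)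
    deck_mx 'I_a.+1 D (enum_rank s) (enum_rank [ffun c => s (ordS c)]))%R.
Proof.
under eq_bigr => s _ do rewrite deck_mxE -sum1dep_card natr_sum.
rewrite (exchange_big_dep xpredT) //= -sum1dep_card natr_sum big_mkcond.
apply: eq_bigr => w _.
rewrite -alternates_deck12 ?size_map ?size_pile_order // map_flatten -map_comp.
have := alternates_flatten
  (fun c => [seq tnth D i | i <- enum 'I_(2 * n) & w i == c]).
rewrite -sum1dep_card => /(congr1 (fun m => m%:R : int)%R).
rewrite natr_sum => count; transitivity
  ((alternates true (flatten [seq [seq tnth D i | i <- enum 'I_(2 * n) & w i == c]
     | c <- enum 'I_a.+1]) == Some true)%:R : int)%R; first by case: ifP.
rewrite -count; apply: eq_bigl => s; congr (_ && _).
by apply: eq_forallb => c; rewrite ffunE.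
Qed.

(** * Invariance under the relation $R$ *)

Lemma R_step_deck_mx (C : finType) n D1 D2 :
  R_step n D1 D2 -> deck_mx C D1 = deck_mx C D2.
Proof.
case=> bal [_ [al [be [ga [def1 [-> be_bal]]]]]].
(* Equal counts do not exclude other labels in [be]; the balance of [D1] does. *)
have be12 : all (mem [:: 1; 2]) be.
  apply/allP => x xbe; have : x \in D1 by rewrite def1 !mem_cat xbe orbT.
  rewrite (perm_mem bal) mem_cat !mem_nseq !inE.
  by case/orP=> /andP[_ ->]; rewrite ?orbT.
rewrite def1 /deck_mx !big_cat /=; congr (_ * (_ * _))%R.
rewrite -/(deck_mx C be) -/(deck_mx C (star be)).
by rewrite deck_mx_star deck_mx_balanced.
Qed.

Theorem theorem4p1 (n : nat) (hn : 1 <= n) (D1 D2 : (2 * n).-tuple nat)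
    (hD1 : balanced_deck n D1) (hD2 : balanced_deck n D2)
    (hR : R_related n D1 D2) (a : nat) (ha : 1 <= a) :
  transition_prob a (deck12 n) D1 = transition_prob a (deck12 n) D2.
Proof.
case: a ha => // a _; rewrite !transition_probE; congr (_ / _)%R.
have D12 : deck_mx 'I_a.+1 D1 = deck_mx 'I_a.+1 D2.
  elim: hR => // [u v /R_step_deck_mx //|u v t _ + _]; exact: etrans.
(* The matrices have integer entries, so the two cardinalities are compared in [int]. *)
suff: forall m k : nat, (m%:R = k%:R :> int)%R -> m = k.
  by move=> inj; congr _%:R%R; apply: inj; rewrite !card_pile_order D12.
by move=> m k /eqP; rewrite Num.Theory.eqr_nat => /eqP.
Qed.
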